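(* There exists a diffeomorphism $g:M\to M$ with a transitive hyperbolic set $\Gamma$ admitting a continuous $Dg$-invariant splitting $T_\Gamma M=E\oplus F$ which is not dominated and such that $F$ is sectionally expanding and $E$ is sectionally contracting.
   Context: $M$ is a compact finite-dimensional Riemannian manifold and $g$ is a $C^1$ diffeomorphism. A compact set $\Gamma\subset M$ with $g(\Gamma)=\Gamma$ is transitive if there exists $x\in\Gamma$ such that the closure of $\{g^n(x):n\ge1\}$ equals $\Gamma$. It is hyperbolic if there is a continuous $Dg$-invariant splitting $T_\Gamma M=E^s\oplus E^u$ with $E^s$ uniformly contracted and $E^u$ uniformly expanded by $Dg$. A $Dg$-invariant subbundle $F$ of $T_\Gamma M$ is sectionally expanding if $\dim F_x\ge2$ is constant and there are $C,\lambda>0$ such that $|\det(Dg^n|_{L_x})|>Ce^{\lambda n}$ for every $x\in\Gamma$, every two-dimensional subspace $L_x\subset F_x$ and all $n\ge1$. A $Dg$-invariant subbundle $E$ is sectionally contracting if it is sectionally expanding for $g^{-1}$. A continuous $Dg$-invariant splitting $T_\Gamma M=E\oplus F$ with nonzero fibers is dominated if there are $K,\lambda>0$ with $\|Dg^n|_{E_x}\|\cdot\|Dg^{-n}|_{F_{g^n(x)}}\|<Ke^{-\lambda n}$ for all $x\in\Gamma$ and all $n\ge1$. *)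

(* Defs.v *)
From mathcomp Require Import all_boot all_order all_algebra.
From mathcomp Require Import all_classical all_reals all_analysis.

Set Implicit Arguments.
Unset Strict Implicit.
Unset Printing Implicit Defensive.

Import Order.TTheory GRing.Theory Num.Theory.
Import numFieldNormedType.Exports.

Local Open Scope classical_set_scope.
Local Open Scope ring_scope.

(* C^k on an open set U.  In finite dimension, continuity of x |-> df_x is the
   same as continuity of x |-> df_x(v) for every fixed v, and likewise at each
   higher order. *)
Fixpoint Ck_on (R : realType) (V W : normedModType R) (k : nat)
    (U : set V) (f : V -> W) : Prop :=
  if k is k'.+1 then
    (forall x, U x -> differentiable f x) /\
    (forall v, Ck_on k' U (fun x => 'd f x v))
  else forall x, U x -> {for x, continuous f}.

Definition smooth_on (R : realType) (V W : normedModType R)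
    (U : set V) (f : V -> W) : Prop := forall k, Ck_on k U f.

(* Smooth manifolds without boundary.  The atlas is a family of charts indexed
   by [chart_idx]; [chart_at] selects a chart around each point, which is used
   below to realise the tangent space.  Only compact manifolds are considered
   in the sequel, for which second countability is automatic. *)
Record smoothManifold (R : realType) := SmoothManifold {
  carrier :> topologicalType ;
  mdim : nat ;
  chart_idx : Type ;
  dom : chart_idx -> set carrier ;
  chart : chart_idx -> carrier -> 'rV[R]_mdim ;
  chart_inv : chart_idx -> 'rV[R]_mdim -> carrier ;
  chart_at : carrier -> chart_idx ;
  manifold_hausdorff : hausdorff_space carrier ;
  dom_open : forall i, open (dom i) ;
  cod_open : forall i, open (chart i @` dom i) ;
  chartK : forall i x, dom i x -> chart_inv i (chart i x) = x ;
  chart_continuous : forall i x, dom i x -> {for x, continuous (chart i)} ;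
  chart_inv_continuous : forall i y, (chart i @` dom i) y ->
    {for y, continuous (chart_inv i)} ;
  chart_at_dom : forall x, dom (chart_at x) x ;
  transition_smooth : forall i j,
    smooth_on (chart i @` (dom i `&` dom j)) (chart j \o chart_inv i)
}.

(* The tangent space T_xM is 'rV[R]_(mdim M), a tangent vector being identified
   with its coordinates in the chart [chart_at x].  The next two maps convert
   between these coordinates and those in an arbitrary chart i around x. *)
Definition to_chart (R : realType) (M : smoothManifold R) (i : chart_idx M)
    (x : M) : 'End('rV[R]_(mdim M)) :=
  linfun ('d (chart i \o chart_inv (chart_at x)) (chart (chart_at x) x)).

Definition from_chart (R : realType) (M : smoothManifold R) (i : chart_idx M)
    (x : M) : 'End('rV[R]_(mdim M)) :=
  linfun ('d (chart (chart_at x) \o chart_inv i) (chart i x)).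

(* D f_x : T_xM -> T_{f x}M *)
Definition tangent_map (R : realType) (M : smoothManifold R) (f : M -> M)
    (x : M) : 'End('rV[R]_(mdim M)) :=
  linfun ('d (chart (chart_at (f x)) \o f \o chart_inv (chart_at x))
             (chart (chart_at x) x)).

Definition C1_map (R : realType) (M : smoothManifold R) (f : M -> M) : Prop :=
  continuous f /\
  forall i j, Ck_on 1 (chart i @` (dom i `&` f @^-1` dom j))
                      (chart j \o f \o chart_inv i).

Record diffeo (R : realType) (M : smoothManifold R) := Diffeo {
  diffeo_fun :> M -> M ;
  diffeo_inv : M -> M ;
  diffeoK : cancel diffeo_fun diffeo_inv ;
  diffeo_invK : cancel diffeo_inv diffeo_fun ;
  diffeo_C1 : C1_map diffeo_fun ;
  diffeo_inv_C1 : C1_map diffeo_inv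
}.

(* [inner x] is the inner product on T_xM; smoothness is that of its
   coefficients in every chart. *)
Record riemannianManifold (R : realType) := RiemannianManifold {
  manifold :> smoothManifold R ;
  inner : manifold -> 'rV[R]_(mdim manifold) -> 'rV[R]_(mdim manifold) -> R ;
  inner_linear : forall x a u v w,
    inner x (a *: u + v) w = a * inner x u w + inner x v w ;
  inner_sym : forall x u v, inner x u v = inner x v u ;
  inner_gt0 : forall x u, u != 0 -> 0 < inner x u u ;
  inner_smooth : forall (i : chart_idx manifold) (v w : 'rV[R]_(mdim manifold)),
    smooth_on (chart i @` dom i)
      (fun y : 'rV[R]_(mdim manifold) => let x := chart_inv i y in
         inner x (from_chart i x v) (from_chart i x w) : R)
}.

Section Dynamics.
Variables (R : realType) (M : riemannianManifold R).
Implicit Types (g : diffeo M) (f : M -> M) (Gamma : set M).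

Local Notation TM := 'rV[R]_(mdim M).
(* A subbundle of T_Gamma M is given by its fibres; only the fibres over Gamma
   are ever used. *)
Implicit Types (E F : M -> {vspace TM}).

Definition tnorm (x : M) (v : TM) : R := Num.sqrt (inner x v v).

(* Operator norm of the restriction to L of T : T_xM -> T_yM. *)
Definition opnorm (x y : M) (T : 'End(TM)) (L : {vspace TM}) : R :=
  sup [set tnorm y (T v) | v in [set v | v \in L /\ tnorm x v <= 1]].

Definition orthonormal_basis (x : M) (L : {vspace TM}) k (u : k.-tuple TM) :=
  basis_of L u /\
  forall a b : 'I_k, inner x (tnth u a) (tnth u b) = (a == b)%:R.

(* Matrix of T : T_xM -> T_yM with respect to orthonormal families u of T_xM
   and w of T_yM. *)
Definition matrix_in (y : M) (T : 'End(TM)) k (u w : k.-tuple TM) : 'M[R]_k :=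
  \matrix_(a, b) inner y (T (tnth u a)) (tnth w b).

Definition transitive_set g Gamma : Prop :=
  exists2 x, Gamma x &
    closure [set iter n g x | n in [set n : nat | (1 <= n)%N]] = Gamma.

Definition invariant_subbundle g Gamma E : Prop :=
  forall x, Gamma x -> (tangent_map g x @: E x)%VS = E (g x).

(* Near each point of Gamma, E has a frame over Gamma whose chart coordinates
   are continuous. *)
Definition continuous_subbundle Gamma E : Prop :=
  forall x, Gamma x ->
    exists (U : set M) (k : nat) (b : 'I_k -> M -> TM),
      [/\ open U, U x, U `<=` dom (chart_at x),
          (forall y, Gamma y -> U y ->
             basis_of (to_chart (chart_at x) y @: E y)%VS
                      [tuple b a y | a < k])
        & forall a, {within Gamma `&` U, continuous (b a)}].

Definition continuous_invariant_splitting g Gamma E F : Prop :=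
  [/\ continuous_subbundle Gamma E,
      continuous_subbundle Gamma F,
      invariant_subbundle g Gamma E,
      invariant_subbundle g Gamma F
    & forall x, Gamma x ->
        (E x + F x)%VS = fullv /\ (E x :&: F x)%VS = 0%VS].

Definition uniformly_contracted g Gamma E : Prop :=
  exists C lambda : R, [/\ 0 < C, 0 < lambda &
    forall x v (n : nat), Gamma x -> v \in E x -> (1 <= n)%N ->
      tnorm (iter n g x) (tangent_map (iter n g) x v)
        <= C * expR (- (lambda * n%:R)) * tnorm x v].

Definition uniformly_expanded g Gamma E : Prop :=
  exists C lambda : R, [/\ 0 < C, 0 < lambda &
    forall x v (n : nat), Gamma x -> v \in E x -> (1 <= n)%N ->
      C * expR (lambda * n%:R) * tnorm x v
        <= tnorm (iter n g x) (tangent_map (iter n g) x v)].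

Definition hyperbolic_set g Gamma : Prop :=
  exists Es Eu : M -> {vspace TM},
    [/\ continuous_invariant_splitting g Gamma Es Eu,
        uniformly_contracted g Gamma Es
      & uniformly_expanded g Gamma Eu].

(* The determinant of Df^n : L -> Df^n(L) is taken in orthonormal bases of
   these two Euclidean planes; its absolute value does not depend on the
   bases. *)
Definition sectionally_expanding f Gamma F : Prop :=
  (exists2 k : nat, (2 <= k)%N & forall x, Gamma x -> \dim (F x) = k) /\
  exists C lambda : R, [/\ 0 < C, 0 < lambda &
    forall x (L : {vspace TM}) (n : nat), Gamma x ->
      (L <= F x)%VS -> \dim L = 2%N -> (1 <= n)%N ->
      let T := tangent_map (iter n f) x in
      let y := iter n f x in
      forall u w : 2.-tuple TM,
        orthonormal_basis x L u -> orthonormal_basis y (T @: L)%VS w ->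
        C * expR (lambda * n%:R) < `| \det (matrix_in y T u w) |].

Definition sectionally_contracting g Gamma E : Prop :=
  sectionally_expanding (diffeo_inv g) Gamma E.

Definition dominated g Gamma E F : Prop :=
  exists K lambda : R, [/\ 0 < K, 0 < lambda &
    forall x (n : nat), Gamma x -> (1 <= n)%N ->
      let y := iter n g x in
      opnorm x y (tangent_map (iter n g) x) (E x) *
      opnorm y x (tangent_map (iter n (diffeo_inv g)) y) (F y)
        < K * expR (- (lambda * n%:R))].

End Dynamics.

(* Main.v *)
(* A hyperbolic fixed point suffices.  On the product of four real projective
   lines, with the metric [dt^2 / (1 + t^2)^2] on each factor, the diagonal map
   [diag(2, 1/8, 1/2, 8)] extends the linear map of [R^4] and fixes the origin.
   The planes [E] of the first two coordinates and [F] of the last two have area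
   factors [1/4] and [4], so [E] is sectionally contracting and [F] sectionally
   expanding; but [E] contains the expanded direction [2] and [F] the contracted
   direction [1/2], which forbids domination.  The hyperbolic splitting groups
   the coordinates as [1/8, 1/2] and [2, 8]. *)
From HB Require Import structures.
Require Import Defs.
From mathcomp Require Import all_boot all_order all_algebra.
From mathcomp Require Import all_classical all_reals all_analysis.
From mathcomp Require Import ring lra.

Set Implicit Arguments.
Unset Strict Implicit.
Unset Printing Implicit Defensive.

Import Order.TTheory GRing.Theory Num.Theory.
Import numFieldNormedType.Exports.

Local Open Scope classical_set_scope.
Local Open Scope ring_scope.

(** * Calculus of [Ck_on]: locality, algebraic operations, coordinates, row vectors *)

Section Smoothness.
Context {R : realType}.
Implicit Types V W : normedModType R.

(** The first-order expansion at [x] depends only on the germ: that of [f] is also one for [g], and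
    uniqueness of the differential identifies ['d g x] with ['d f x]. *)
Lemma near_eq_is_diff V W (f g : V -> W) (x : V) :
  {near x, f =1 g} -> differentiable f x -> is_diff x g ('d f x).
Proof.
move=> fg df.
have dg : g \o shift x = cst (g x) + 'd f x +o_ 0 id.
  have /diff_locallyP[_ /eqaddoP fE] := df.
  apply/eqaddoP => e e0; have := fE e e0.
  have fgx := nbhs_singleton fg.
  have : \forall h \near (0 : V), f (h + x) = g (h + x).
    rewrite (near_shift x); apply: filterS fg => h.
    by rewrite /= sub0r addrNK.
  by apply: filterS2 => h /= fgh; rewrite !fctE /= fgh fgx.
have dfc : continuous ('d f x) by exact: diff_continuous.
have ge := diff_unique dfc dg.
apply: DiffDef => //; apply/diff_locallyP; rewrite ge; split => //.
Qed.

Lemma open_eq_is_diff V W (U : set V) (f g : V -> W) (x : V) :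
  open U -> {in U, f =1 g} -> U x -> differentiable f x ->
  is_diff x g ('d f x).
Proof.
move=> oU fg Ux; apply: near_eq_is_diff.
by apply: filterS (open_nbhs_nbhs (conj oU Ux)) => y Uy; rewrite fg ?inE.
Qed.

(** Since [U] is open, equality on [U] is equality near each of its points; the differentials then
    agree on [U] as well, which feeds the induction. *)
Lemma eq_Ck_on V W k (U : set V) (f g : V -> W) :
  open U -> {in U, f =1 g} -> Ck_on k U f -> Ck_on k U g.
Proof.
move=> oU; elim: k f g => [|k IH] f g fg /=.
  move=> cf x Ux; have := cf x Ux.
  rewrite /prop_for /continuous_at fg ?inE// => cfx.
  apply: cvg_trans cfx; apply: near_eq_cvg.
  by apply: filterS (open_nbhs_nbhs (conj oU Ux)) => y Uy; rewrite fg ?inE.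
move=> [df Cdf]; split=> [x Ux|v].
  by have [] := open_eq_is_diff oU fg Ux (df x Ux).
apply: IH (Cdf v) => x /[!inE] Ux.
by have [_ ->] := open_eq_is_diff oU fg Ux (df x Ux).
Qed.

Lemma Ck_onW V W k (U : set V) (f : V -> W) : Ck_on k.+1 U f -> Ck_on k U f.
Proof.
elim: k f => [|k IH] f /= [df Cdf].
  by move=> x Ux; apply: differentiable_continuous; exact: df.
by split=> // v; apply: IH; exact: Cdf.
Qed.

Lemma Ck_on_cst V W k (U : set V) (c : W) : Ck_on k U (fun _ : V => c).
Proof.
elim: k c => [|k IH] c /=; first by move=> x _; exact: cst_continuous.
split=> [x _|v]; first exact: differentiable_cst.
rewrite (_ : (fun x => _) = fun=> 0); first exact: IH.
by apply/funext => x; rewrite [X in X v](diff_cst c x).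
Qed.

Lemma Ck_onD V W k (U : set V) (f g : V -> W) : open U ->
  Ck_on k U f -> Ck_on k U g -> Ck_on k U (fun x => f x + g x).
Proof.
move=> oU; elim: k f g => [|k IH] f g /=.
  by move=> cf cg x Ux; apply: continuousD; [exact: cf|exact: cg].
move=> [df Cf] [dg Cg]; split=> [x Ux|v].
  by apply: (@differentiableD _ _ _ f g); [exact: df|exact: dg].
apply: eq_Ck_on (IH _ _ (Cf v) (Cg v)) => // x /[!inE] Ux.
by rewrite [X in _ = X v](diffD (df _ Ux) (dg _ Ux)).
Qed.

(** The Leibniz rule keeps one factor undifferentiated, so the induction also needs [f] and [g] at
    the lower order, given by [Ck_onW]. *)
Lemma Ck_onM V k (U : set V) (f g : V -> R) : open U ->
  Ck_on k U f -> Ck_on k U g -> Ck_on k U (fun x => f x * g x).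
Proof.
move=> oU; elim: k f g => [|k IH] f g /=.
  by move=> cf cg x Ux; apply: continuousM; [exact: cf|exact: cg].
move=> Cf1 Cg1; have [[df Cf] [dg Cg]] := (Cf1, Cg1).
split=> [x Ux|v].
  by apply: (@differentiableM _ _ f g); [exact: df|exact: dg].
have := Ck_onD oU (IH _ _ (Ck_onW Cf1) (Cg v)) (IH _ _ (Ck_onW Cg1) (Cf v)).
apply: eq_Ck_on => // x /[!inE] Ux.
by rewrite [X in _ = X v](diffM (df _ Ux) (dg _ Ux)).
Qed.

Lemma Ck_onZl V W k (U : set V) (f : V -> R) (w : W) : open U ->
  Ck_on k U f -> Ck_on k U (fun x => f x *: w).
Proof.
move=> oU; elim: k f => [|k IH] f /=.
  by move=> cf x Ux; apply: continuousZr_tmp; exact: cf.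
move=> [df Cf]; split=> [x Ux|v]; first exact: differentiableZl (df x Ux).
apply: eq_Ck_on (IH _ (Cf v)) => // x /[!inE] Ux.
by rewrite [X in _ = X v](diffZl w (df _ Ux)).
Qed.

(** The derivative of [1/f] is [- (1/f)^2] times that of [f]; the induction hypothesis already gives
    [1/f] at order [k], so this product is of order [k]. *)
Lemma Ck_onV V k (U : set V) (f : V -> R) : open U ->
  (forall x, U x -> f x != 0) -> Ck_on k U f -> Ck_on k U (fun x => (f x)^-1).
Proof.
move=> oU f0; elim: k => [|k IH].
  by move=> cf x Ux; apply: continuousV; [exact: f0|exact: cf].
move=> Cf1; have [df Cf] := Cf1; split=> [x Ux|v].
  by apply: differentiableV; [exact: df|exact: f0].
have CV := IH (Ck_onW Cf1).
have := Ck_onM oU (Ck_onM oU (Ck_on_cst k U (-1 : R)) (Ck_onM oU CV CV)) (Cf v).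
apply: eq_Ck_on => // x /[!inE] Ux.
rewrite [X in _ = X v](diffV (df _ Ux) (f0 _ Ux)) /=.
by rewrite mulN1r -invfM -expr2.
Qed.

Lemma Ck_on_sum V W (I : Type) (r : seq I) k (U : set V) (f : I -> V -> W) :
  open U -> (forall i, Ck_on k U (f i)) ->
  Ck_on k U (fun x => \sum_(i <- r) f i x).
Proof.
move=> oU Cf; elim: r => [|i r IH].
  by under eq_fun do rewrite big_nil; exact: Ck_on_cst.
by under eq_fun do rewrite big_cons; exact: Ck_onD.
Qed.

Lemma diff_coord n (y : 'rV[R]_n) (j : 'I_n) :
  'd (fun z : 'rV[R]_n => z 0 j : R) y = (fun v => v 0 j) :> (_ -> _).
Proof.
have flin : linear (fun z : 'rV[R]_n => z 0 j : R).
  by move=> a u v; rewrite !mxE.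
pose f : {linear 'rV[R]_n -> R} :=
  HB.pack (fun z : 'rV[R]_n => z 0 j : R) (GRing.isLinear.Build _ _ _ _ _ flin).
exact: (@diff_lin _ _ _ f y (@coord_continuous _ _ _ _ _)).
Qed.

Lemma Ck_on_coord n k (U : set 'rV[R]_n) (j : 'I_n) :
  Ck_on k U (fun z : 'rV[R]_n => z 0 j : R).
Proof.
case: k => [|k] /=; first by move=> x _; exact: coord_continuous.
split=> [x _|v]; first exact: differentiable_coord.
by under eq_fun do rewrite diff_coord; exact: Ck_on_cst.
Qed.

Lemma is_diff_row V n (f : 'I_n -> V -> R) (x : V) :
  (forall k, differentiable (f k) x) ->
  is_diff x (fun z => \row_k f k z) (fun v => \row_k 'd (f k) x v).
Proof.
move=> df.
(* As a finite sum of scalar functions times fixed basis vectors, the row map is covered by the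
   rules for sums and for scaling. *)
have rowE (h : 'I_n -> V -> R) :
    (fun z => \row_k h k z) = \sum_k (fun z => h k z *: delta_mx 0 k).
  apply/funext => z; rewrite [LHS]row_sum_delta fct_sumE.
  by apply: eq_bigr => k _; rewrite mxE.
rewrite !rowE; elim/big_ind2 : _ => [|f1 d1 f2 d2 H1 H2|k _].
- exact: is_diff_cst.
- exact: is_diffD.
- by apply: DiffDef; [exact: differentiableZl|exact: diffZl].
Qed.

Lemma Ck_on_row V n k (U : set V) (f : 'I_n -> V -> R) : open U ->
  (forall j, Ck_on k U (f j)) -> Ck_on k U (fun z => \row_j f j z).
Proof.
move=> oU Cf; have := Ck_on_sum (index_enum _) oU
  (fun j => Ck_onZl (delta_mx 0 j : 'rV_n) oU (Cf j)).
apply: eq_Ck_on => // x _; rewrite [RHS]row_sum_delta.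
by apply: eq_bigr => j _; rewrite mxE.
Qed.

End Smoothness.

(** * The projective line as the one-point compactification of [R] *)

Section ProjectiveLine.
Context {R : realType}.
Local Notation P1 := (one_point_compactification R).

(** True by conversion: the neighbourhoods of [Some t] are the sets whose preimage under [Some] is a
    neighbourhood of [t]. *)
Lemma continuous_atSome (T : topologicalType) (f : P1 -> T) (t : R) :
  {for t, continuous (f \o Some)} -> {for (Some t : P1), continuous f}.
Proof. by []. Qed.

Lemma hausdorff_proj_line : hausdorff_space P1.
Proof.
(* The compact closed unit ball around [a] and its complement separate [a] from infinity. *)
have sep (a : R) : ~ cluster (nbhs (Some a : P1)) (None : P1).
  have cK : compact (closed_ball a 1 : set R) by exact: closed_ballR_compact.
  have clK : closed (closed_ball a 1 : set R) by exact: closed_ball_closed.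
  pose A : set P1 := Some @` (closed_ball a 1 : set R).
  pose B : set P1 := (Some @` (~` (closed_ball a 1 : set R))) `|` [set None].
  have nA : nbhs (Some a : P1) A.
    apply: one_point_compactification_some_nbhs.
    by apply: filterS (nbhsx_ballx a 1 ltr01); exact: subset_closed_ball.
  have nB : nbhs (None : P1) B by exists (closed_ball a 1 : set R).
  move=> /(_ A B nA nB)[x [[t Kt <-] [[s nKs [st]]|//]]].
  by apply: nKs; rewrite st.
case=> [a|] [b|] //; last 2 first.
- by move=> /sep.
- by move=> ab; case: (sep b) => A B nA nB; rewrite setIC; exact: ab.
move=> ab; congr Some; apply: (@Rhausdorff R) => A B nA nB.
have [x [[t At <-] [s Bs [st]]]] := ab (Some @` A) (Some @` B)
  (one_point_compactification_some_nbhs _ _ nA)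
  (one_point_compactification_some_nbhs _ _ nB).
by exists t; split => //; rewrite -st.
Qed.

(* The affine coordinate [t] for [b = false]; the coordinate [1/t] around the
   point at infinity [None] for [b = true]. *)
Definition coord1 (b : bool) (x : P1) : R :=
  if x is Some t then (if b then t^-1 else t) else 0.

Definition coord1_inv (b : bool) (t : R) : P1 :=
  if b then (if t == 0 then None else Some t^-1) else Some t.

Definition dom1 (b : bool) : set P1 :=
  if b then ~` [set Some 0] else ~` [set None].

Definition scale1 (a : R) : P1 -> P1 := omap ( *%R a).

Lemma dom1_coord1_inv b t : dom1 b (coord1_inv b t).
Proof.
case: b => //=; case: eqP => //= /eqP t0 [] /eqP.
by rewrite invr_eq0 (negPf t0).
Qed.

Lemma coord1K b x : dom1 b x -> coord1_inv b (coord1 b x) = x.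
Proof.
case: b x => -[t|] //= t0; rewrite ?eqxx// invr_eq0 invrK ifN //.
by apply/eqP => t00; apply: t0; rewrite t00.
Qed.

(* With [0^-1 = 0], the formula is valid even when the image of the point lies
   outside the chart [c]. *)
Lemma coord1_scale1_inv (a : R) b c t :
  coord1 c (scale1 a (coord1_inv b t)) =
  (if c then a^-1 else a) * (if b == c then t else t^-1).
Proof.
have [->|t0] := eqVneq t 0; case: b c => -[] /=.
all: rewrite ?eqxx ?(negPf t0) /= ?invr0 ?mulr0 ?invfM ?invrK ?invr0 ?mulr0 //.
Qed.

Lemma scale11 : scale1 1 = id.
Proof. by apply/funext => -[t|] //=; rewrite mul1r. Qed.

Lemma scale1M a b : scale1 a \o scale1 b = scale1 (a * b).
Proof. by apply/funext => -[t|] //=; rewrite mulrA. Qed.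

Lemma coord1_invE b c t :
  coord1 c (coord1_inv b t) = if b == c then t else t^-1.
Proof.
have := coord1_scale1_inv 1 b c t.
by rewrite scale11 invr1 if_same mul1r.
Qed.

Lemma coord1_invK b : cancel (coord1_inv b) (coord1 b).
Proof. by move=> t; rewrite coord1_invE eqxx. Qed.

(** A nonzero scaling fixes [0] and infinity, and the only point of one chart missed by the other is
    its own origin [t = 0]. *)
Lemma dom1_scale1_inv (a : R) b c t : a != 0 ->
  dom1 c (scale1 a (coord1_inv b t)) <-> (b != c -> t != 0).
Proof.
move=> a0; have someE (s : R) : scale1 a (Some s) <> Some 0 <-> s <> 0.
  by split=> s0 E; apply: s0; [rewrite E /= mulr0|case: E => /eqP;
    rewrite mulf_eq0 (negPf a0) => /eqP].
have [->|/[dup] t0 /eqP t0'] := eqVneq t 0; case: b c => -[];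
  rewrite /coord1_inv ?eqxx ?(negPf t0).
all: split=> //=.
all: try by move=> /(_ isT).
all: try by move=> /someE.
all: try by move=> _; apply/someE => //; apply/eqP; rewrite ?invr_eq0.
Qed.

Lemma dom1_open b : open (dom1 b).
Proof.
by case: b; apply: closed_openC; apply: accessible_closed_set1;
  apply: hausdorff_accessible; exact: hausdorff_proj_line.
Qed.

(** The inversion [t |-> 1/t], exchanging [0] and infinity; it transfers continuity questions at
    infinity to a finite point. *)
Definition inv1 (x : P1) : P1 :=
  if x is Some t then coord1_inv true t else Some 0.

Lemma inv1_continuous : continuous inv1.
Proof.
case=> [t|].
  apply: continuous_atSome; rewrite /= /prop_for /continuous_at /=.
  have [->|t0] := eqVneq t 0.
    (* At [0] the value is infinity, whose neighbourhoods contain complements of compact sets [K].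
       Such a [K] is bounded, so [1/s] leaves it once [s] is small. *)
    move=> A [K [cK _] KA] /=.
    have [M [_ KM]] := compact_bounded cK.
    have {}KM x : K x -> `|x| <= `|M| + 1.
      by apply: KM; rewrite (le_lt_trans (ler_norm _))// ltrDl.
    have M0 : 0 < (`|M| + 1)^-1 by rewrite invr_gt0 ltr_wpDl.
    apply: filterS (nbhs0_lt M0) => s sM; apply: KA => /=.
    case: eqP => [_|/eqP s0]; [by right|left].
    exists s^-1 => // /KM; rewrite normfV leNgt => /negP; apply.
    by rewrite -[ltLHS]invrK ltf_pV2 ?posrE ?invr_gt0 ?normr_gt0 ?ltr_wpDl.
  apply: (@cvg_trans _ ((Some : R -> P1) \o GRing.inv @ t)).
    apply: near_eq_cvg; near=> s => /=.
    by rewrite ifN //; near: s; exact: open_nbhs_nbhs (conj (@open_neq _ 0) t0).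
  have cS := @one_point_compactification_some_continuous R t^-1.
  exact: (continuous_comp (inv_continuous t0) cS).
(* At infinity: outside the ball of radius [1/e], inverses have absolute value less than [e]. *)
move=> A /nbhs_ballP[e e0 eA]; exists (closed_ball (0 : R) e^-1).
  split; last exact: closed_ball_closed.
  by apply: closed_ballR_compact; rewrite invr_gt0.
move=> x [[s + <-{x}]|-> /=]; last by apply: eA; exact: ballxx.
rewrite closed_ballE ?invr_gt0// /closed_ball_ /= sub0r normrN => /negP.
rewrite -ltNge => se; have s0 : s != 0.
  by rewrite -normr_gt0 (lt_trans _ se)// invr_gt0.
rewrite ifN//; apply: eA; rewrite -ball_normE /= sub0r normrN normfV.
by rewrite -[ltRHS]invrK ltf_pV2// posrE ?invr_gt0 ?normr_gt0.
Unshelve. all: by end_near. Qed.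

Lemma scale1_continuous a : a != 0 -> continuous (scale1 a).
Proof.
have scS b : continuous (scale1 b \o Some).
  move=> t; have cS := @one_point_compactification_some_continuous R (b * t).
  exact: (continuous_comp (@mulrl_continuous R b t) cS).
move=> a0 [t|]; first exact: (continuous_atSome (scS a t)).
(* Conjugation by the inversion turns continuity of [scale1 a] at infinity into continuity of
   [scale1 a^-1] at [0]. *)
have -> : scale1 a = inv1 \o scale1 a^-1 \o inv1.
  apply/funext => -[t|] /=; last by rewrite mulr0 eqxx.
  have [->|t0] /= := eqVneq t 0; first by rewrite mulr0.
  by rewrite mulf_eq0 !invr_eq0 (negPf a0) (negPf t0) invfM !invrK.
apply: continuous_comp; first exact: inv1_continuous.
apply: continuous_comp; last exact: inv1_continuous.
exact: (continuous_atSome (scS a^-1 0)).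
Qed.

Lemma coord1_continuous b x : dom1 b x -> {for x, continuous (coord1 b)}.
Proof.
have c0 y : y <> None -> {for y, continuous (coord1 false)}.
  by case: y => // t _; apply: continuous_atSome => A.
case: b => /= xb; last exact: c0.
(* This holds even at [Some 0], outside the chart, where both sides take the default value [0]. *)
have -> : coord1 true = coord1 false \o inv1.
  apply/funext => -[t|] //=; case: eqP => [->|//]; by rewrite invr0.
apply: continuous_comp; first exact: inv1_continuous.
apply: c0; case: x xb => //= t t0; case: eqP => // t00.
by case: t0; rewrite t00.
Qed.

Lemma coord1_inv_continuous b : continuous (coord1_inv b).
Proof.
have cS : continuous (coord1_inv false) by move=> t A.
case: b => // t.
have -> : coord1_inv true = inv1 \o coord1_inv false by [].
apply: continuous_comp; [exact: cS|exact: inv1_continuous].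
Qed.

End ProjectiveLine.

(** * Powers of the projective line as smooth manifolds with product charts *)

Section ProjectiveLinePower.
Context {R : realType} {n : nat}.
Local Notation P1 := (one_point_compactification R).
Local Notation Pn := (prod_topology (fun _ : 'I_n => P1)).
Implicit Types (i j : 'I_n -> bool) (a : 'I_n -> R) (x : Pn) (y v w : 'rV[R]_n).

Definition domn i : set Pn := [set x | forall k, dom1 (i k) (x k)].

Definition coordn i x : 'rV[R]_n := \row_k coord1 (i k) (x k).

Definition coordn_inv i y : Pn := fun k => coord1_inv (i k) (y 0 k).

Definition scalen a x : Pn := fun k => scale1 (a k) (x k).

(** On each factor the affine chart is chosen unless the point is infinity, so tangent vectors at
    finite points are read in affine coordinates. *)
Definition chart_atn x : 'I_n -> bool := fun k => x k == None.

Lemma domn_coordn_inv i y : domn i (coordn_inv i y).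
Proof. by move=> k; exact: dom1_coord1_inv. Qed.

Lemma coordnK i x : domn i x -> coordn_inv i (coordn i x) = x.
Proof. by move=> ix; apply/funext => k; rewrite /coordn_inv mxE coord1K. Qed.

Lemma coordn_invK i : cancel (coordn_inv i) (coordn i).
Proof. by move=> y; apply/rowP => k; rewrite mxE coord1_invK. Qed.

Lemma domn_chart_atn x : domn (chart_atn x) x.
Proof. by move=> k; rewrite /chart_atn; case: (x k). Qed.

Lemma coordn_domn i : coordn i @` domn i = setT.
Proof.
apply/seteqP; split=> // y _; exists (coordn_inv i y).
  exact: domn_coordn_inv.
exact: coordn_invK.
Qed.

Lemma domn_open i : open (domn i).
Proof.
rewrite openE => x ix; apply: (@filter_forall _ 'I_n (fun k z => dom1 (i k) (z k))
  (nbhs x)) => k.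
apply: (@proj_continuous _ (fun=> P1) k x); apply: open_nbhs_nbhs; split => //.
exact: dom1_open.
Qed.

Lemma continuous_row (T : topologicalType) (f : T -> 'rV[R]_n) (t : T) :
  (forall k, {for t, continuous (fun s => f s 0 k)}) -> {for t, continuous f}.
Proof.
move=> cf A [E nE EA].
have : \forall s \near t, forall k, E 0 k (f s 0 k).
  apply: (@filter_forall _ 'I_n (fun k s => E 0 k (f s 0 k)) (nbhs t)) => k.
  by apply: cf; exact: nE.
by apply: filterS => s Es; apply: EA => r k; rewrite ord1.
Qed.

Lemma continuous_prod (T : topologicalType) (f : T -> Pn) (t : T) :
  (forall k, {for t, continuous (fun s => f s k)}) -> {for t, continuous f}.
Proof.
move=> cf; apply/cvg_sup => k U [?/= [[W oW <-]]] /= Wf /filterS; apply.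
by apply: (cf k W); exact: open_nbhs_nbhs.
Qed.

Lemma coordn_continuous i x : domn i x -> {for x, continuous (coordn i)}.
Proof.
move=> ix; apply: continuous_row => k.
rewrite (_ : (fun s => _) = coord1 (i k) \o proj k); last first.
  by apply/funext => s; rewrite mxE.
have px := @proj_continuous _ (fun _ : 'I_n => P1) k x.
exact: (continuous_comp px (coord1_continuous (ix k))).
Qed.

Lemma coordn_inv_continuous i : continuous (coordn_inv i).
Proof.
move=> y; apply: continuous_prod => k.
exact: (continuous_comp (@coord_continuous _ _ _ 0 k y)
  (@coord1_inv_continuous _ (i k) (y 0 k))).
Qed.

Lemma scalen_continuous a : (forall k, a k != 0) -> continuous (scalen a).
Proof.
move=> a0 x; apply: continuous_prod => k.
exact: (continuous_comp (@proj_continuous _ (fun _ : 'I_n => P1) k x)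
  (@scale1_continuous _ _ (a0 k) (x k))).
Qed.

Lemma Pn_compact : compact [set: Pn].
Proof.
have := @tychonoff _ (fun _ : 'I_n => P1) (fun=> setT)
  (fun=> one_point_compactification_compact).
by congr compact; apply/seteqP; split.
Qed.

Lemma Pn_hausdorff : hausdorff_space Pn.
Proof. by apply: hausdorff_product => k; exact: hausdorff_proj_line. Qed.

Lemma scalenM a b x : scalen a (scalen b x) = scalen (fun k => a k * b k) x.
Proof. by apply/funext => k; rewrite /scalen -scale1M. Qed.

Lemma scalen1 x : scalen (fun=> 1) x = x.
Proof. by apply/funext => k; rewrite /scalen scale11. Qed.

(* Coordinate expressions of the diagonal maps in a pair of charts. *)
Definition monomial_map (e : 'I_n -> bool) a y : 'rV[R]_n :=
  \row_k (a k * (if e k then y 0 k else (y 0 k)^-1)).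

Definition monomial_dom (e : 'I_n -> bool) : set 'rV[R]_n :=
  [set y | forall k, ~~ e k -> y 0 k != 0].

(** An equality of total functions, not merely on the overlap of the charts, so it can be rewritten
    under ['d]. *)
Lemma coordn_scalen_inv i j a :
  coordn j \o scalen a \o coordn_inv i =
  monomial_map (fun k => i k == j k) (fun k => if j k then (a k)^-1 else a k).
Proof. by apply/funext => y; apply/rowP => k; rewrite !mxE coord1_scale1_inv. Qed.

Lemma coordn_inv_coordn i j :
  coordn j \o coordn_inv i = monomial_map (fun k => i k == j k) (fun=> 1).
Proof.
by apply/funext => y; apply/rowP => k; rewrite !mxE coord1_invE mul1r.
Qed.

Lemma coordn_dom_scalen i j a : (forall k, a k != 0) ->
  coordn i @` (domn i `&` scalen a @^-1` domn j) =
  monomial_dom (fun k => i k == j k).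
Proof.
move=> a0; apply/seteqP; split=> [_ [x [ix jx] <-] k ik|y ey].
  have := jx k; rewrite -[x](coordnK ix) /scalen.
  by move=> /(dom1_scale1_inv _ _ _ (a0 k)); rewrite coordn_invK; apply.
exists (coordn_inv i y); last exact: coordn_invK.
split; first exact: domn_coordn_inv.
by move=> k; apply/(dom1_scale1_inv _ _ _ (a0 k)); exact: ey.
Qed.

Lemma coordn_dom i j :
  coordn i @` (domn i `&` domn j) = monomial_dom (fun k => i k == j k).
Proof.
(* The overlap of two charts is the case of the identity, all factors being [1]. *)
rewrite -(@coordn_dom_scalen _ _ (fun=> 1)); last by move=> k; exact: oner_neq0.
by congr (_ @` (_ `&` _)); apply/funext => x; rewrite /preimage /= scalen1.
Qed.

Lemma monomial_dom_open e : open (monomial_dom e).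
Proof.
rewrite openE => y ey.
apply: (@filter_forall _ 'I_n (fun k z => ~~ e k -> z 0 k != 0)
  (nbhs y)) => k.
have [|/negP ek] := boolP (e k); first by move=> _; exact: nearW.
have yk : y 0 k != 0 by apply: ey; apply/negP.
have yk0 := open_nbhs_nbhs (conj (@open_neq R 0) yk).
have := @coord_continuous R 1 n 0 k y _ yk0.
by apply: (@filterS _ (nbhs y)) => z zk _.
Qed.

Lemma smooth_monomial_map e a : smooth_on (monomial_dom e) (monomial_map e a).
Proof.
move=> m; have oe := @monomial_dom_open e.
apply: Ck_on_row => // k; apply: Ck_onM => //; first exact: Ck_on_cst.
case: (boolP (e k)) => ek; first exact: Ck_on_coord.
by apply: Ck_onV => //; [move=> y ey; exact: ey|exact: Ck_on_coord].
Qed.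

Lemma diff_monomial_map e a y v : monomial_dom e y ->
  'd (monomial_map e a) y v =
  \row_k (a k * (if e k then v 0 k else - (y 0 k) ^- 2 * v 0 k)).
Proof.
move=> ey.
pose f (k : 'I_n) (z : 'rV[R]_n) : R := a k * (if e k then z 0 k else (z 0 k)^-1).
have df k : is_diff y (f k)
    (fun v => a k * (if e k then v 0 k else - (y 0 k) ^- 2 * v 0 k)).
  have dc := @differentiable_coord R 1 n y 0 k.
  have dck : is_diff y (fun z : 'rV[R]_n => z 0 k : R) (fun v => v 0 k).
    exact: (DiffDef _ dc (diff_coord y k)).
  rewrite /f; case: (boolP (e k)) => ek; first exact: (is_diffZ (a k) dck).
  have dV := differentiableV dc (ey _ ek).
  have dVk : is_diff y (fun z : 'rV[R]_n => (z 0 k)^-1 : R)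
      (fun v => - (y 0 k) ^- 2 * v 0 k).
    apply: (DiffDef _ dV); rewrite (diffV dc (ey _ ek)).
    by apply/funext => z; rewrite /= diff_coord.
  exact: (is_diffZ (a k) dVk).
have [_ ->] := @is_diff_row _ _ _ f y (fun k => @ex_diff _ _ _ _ _ _ _ (df k)).
by apply/rowP => k; rewrite !mxE (@diff_val _ _ _ _ _ _ _ (df k)).
Qed.

(** Left transparent so that charts and dimension reduce by conversion below. *)
Definition proj_line_power : smoothManifold R.
Proof.
refine (@SmoothManifold R Pn n ('I_n -> bool) domn coordn coordn_inv chart_atn
  Pn_hausdorff domn_open _ coordnK coordn_continuous _ domn_chart_atn _).
- by move=> i; rewrite coordn_domn; exact: openT.
- by move=> i y _; exact: coordn_inv_continuous.
- move=> i j; rewrite coordn_dom coordn_inv_coordn; exact: smooth_monomial_map.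
Defined.

End ProjectiveLinePower.

(** * The product metric and its smoothness in every chart *)

Section RoundMetric.
Context {R : realType} {n : nat}.
Local Notation P1 := (one_point_compactification R).
Local Notation Pn := (prod_topology (fun _ : 'I_n => P1)).
Implicit Types (i j : 'I_n -> bool) (a : 'I_n -> R) (x : Pn).
Implicit Types (u v w y : 'rV[R]_n).

(* The density of [dt^2 / (1 + t^2)^2], which is invariant under [t |-> 1/t]. *)
Definition round_density (t : R) : R := (1 + t * t)^-1 * (1 + t * t)^-1.

(** At infinity [coord1 false] returns [0], which is also the coordinate of that point in its chosen
    chart [1/t]. As the density has the same formula in both charts, the value there is the right
    one. *)
Definition round_inner x u v : R :=
  \sum_k round_density (coord1 false (x k)) * (u 0 k * v 0 k).

Lemma sqr1_gt0 (t : R) : 0 < 1 + t * t.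
Proof. by rewrite ltr_wpDr// -expr2 sqr_ge0. Qed.

Lemma round_density_gt0 t : 0 < round_density t.
Proof. by rewrite mulr_gt0 ?invr_gt0 ?sqr1_gt0. Qed.

(** The factor [t ^- 2 * t ^- 2] is the squared derivative of the inversion: this says that the
    inversion is an isometry. *)
Lemma round_densityV t : t != 0 ->
  round_density t^-1 * (t ^- 2 * t ^- 2) = round_density t.
Proof.
move=> t0; rewrite /round_density -!invfM; congr (_^-1).
by field.
Qed.

Lemma round_inner_linear x c u v w :
  round_inner x (c *: u + v) w = c * round_inner x u w + round_inner x v w.
Proof.
rewrite /round_inner mulr_sumr -big_split /=; apply: eq_bigr => k _.
by rewrite !mxE; ring.
Qed.

Lemma round_inner_sym x u v : round_inner x u v = round_inner x v u.
Proof. by apply: eq_bigr => k _; rewrite (mulrC (u 0 k)). Qed.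

Lemma round_inner_gt0 x u : u != 0 -> 0 < round_inner x u u.
Proof.
move=> u0; have [k uk] : exists k, u 0 k != 0.
  apply/existsP; apply: contraNT u0 => /existsPn u0.
  by apply/eqP/rowP => k; rewrite mxE; apply/eqP; rewrite -[_ == _]negbK u0.
rewrite /round_inner (bigD1 k)//= ltr_wpDr//.
  apply: sumr_ge0 => j _.
  by rewrite mulr_ge0 ?(ltW (round_density_gt0 _))// -expr2 sqr_ge0.
by rewrite mulr_gt0 ?round_density_gt0// -expr2 exprn_even_gt0.
Qed.

Lemma from_chartE (i : chart_idx (@proj_line_power R n)) y v :
  from_chart i (coordn_inv i y) v =
  \row_k (if i k == (coord1_inv (i k) (y 0 k) == None) then v 0 k
          else - (y 0 k) ^- 2 * v 0 k).
Proof.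
rewrite /from_chart lfunE /= coordn_inv_coordn coordn_invK diff_monomial_map.
  by apply/rowP => k; rewrite !mxE mul1r.
(* The two charts differ on a factor only if [i k] is the chart at infinity and the point is finite,
   and then [y 0 k] is nonzero. *)
move=> k; rewrite /chart_atn /coordn_inv.
by case: (i k) => //=; case: (eqVneq (y 0 k) 0).
Qed.

(** Invariance of the density under inversion gives the metric the same expression in all charts, so
    smoothness need only be checked for one rational function. *)
Lemma round_inner_chart (i : chart_idx (@proj_line_power R n)) y v w :
  round_inner (coordn_inv i y) (from_chart i (coordn_inv i y) v)
    (from_chart i (coordn_inv i y) w) =
  \sum_k round_density (y 0 k) * (v 0 k * w 0 k).
Proof.
apply: eq_bigr => k _; rewrite !from_chartE !mxE /coordn_inv.
case: (i k) => //=; have [->|yk] //= := eqVneq (y 0 k) 0.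
by rewrite -(round_densityV yk); ring.
Qed.

Lemma smooth_round_inner U v w : open U ->
  smooth_on U
    (fun y => \sum_k round_density (y 0 k) * (v 0 k * w 0 k) : R).
Proof.
move=> oU m; apply: Ck_on_sum => // k; apply: Ck_onM => //; last exact: Ck_on_cst.
have C1 : Ck_on m U (fun y => (1 + y 0 k * y 0 k)^-1 : R).
  apply: Ck_onV => //; first by move=> y _; rewrite gt_eqF// sqr1_gt0.
  apply: Ck_onD => //; first exact: Ck_on_cst.
  by apply: Ck_onM => //; exact: Ck_on_coord.
exact: Ck_onM.
Qed.

Definition round_power : riemannianManifold R.
Proof.
refine (@RiemannianManifold R (@proj_line_power R n) round_inner
  round_inner_linear round_inner_sym round_inner_gt0 _).
move=> i v w m /=; rewrite coordn_domn.
apply: eq_Ck_on (smooth_round_inner v w openT m); first exact: openT.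
by move=> y _; rewrite round_inner_chart.
Defined.

End RoundMetric.

(** * Diagonal diffeomorphisms and their derivative at the origin *)

Section DiagonalDiffeo.
Context {R : realType} {n : nat}.
Implicit Types (a : 'I_n -> R).
Local Notation M := (@round_power R n).

Lemma scalen_C1 a : (forall k, a k != 0) -> C1_map (scalen a : M -> M).
Proof.
move=> a0; split=> [|i j]; first exact: scalen_continuous.
change (Ck_on 1 (coordn i @` (domn i `&` scalen a @^-1` domn j))
  (coordn j \o scalen a \o coordn_inv i)).
rewrite coordn_dom_scalen// coordn_scalen_inv.
exact: (@smooth_monomial_map R n _ _ 1).
Qed.

Lemma scalenK a : (forall k, a k != 0) ->
  cancel (scalen a : M -> M) (scalen (fun k => (a k)^-1)).
Proof.
move=> a0 x; rewrite scalenM -[RHS]scalen1; congr (scalen _ x).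
by apply/funext => k; rewrite mulVf.
Qed.

Lemma scalen_invK a : (forall k, a k != 0) ->
  cancel (scalen (fun k => (a k)^-1)) (scalen a : M -> M).
Proof.
move=> a0 x; rewrite scalenM -[RHS]scalen1; congr (scalen _ x).
by apply/funext => k; rewrite mulfV.
Qed.

Definition diag_diffeo a (a0 : forall k, a k != 0) : diffeo M :=
  @Diffeo R M (scalen a) (scalen (fun k => (a k)^-1)) (scalenK a0)
    (scalen_invK a0) (scalen_C1 a0)
    (@scalen_C1 (fun k => (a k)^-1) (fun k => invr_neq0 (a0 k))).

Definition origin : M := fun=> Some 0.

Lemma scalen_origin a : scalen a origin = origin.
Proof. by apply/funext => k; rewrite /scalen /= mulr0. Qed.

Lemma iter_scalen a m : iter m (scalen a : M -> M) = scalen (fun k => a k ^+ m).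
Proof.
apply/funext => x; elim: m => [|m IH] /=; first by rewrite scalen1.
by rewrite IH scalenM; congr (scalen _ x); apply/funext => k; rewrite exprS.
Qed.

(** The origin is fixed and read in the affine chart, where the map is linear and hence its own
    derivative. *)
Lemma tangent_scalen a v :
  tangent_map (scalen a : M -> M) origin v = \row_k (a k * v 0 k).
Proof.
rewrite /tangent_map lfunE /= coordn_scalen_inv scalen_origin.
rewrite diff_monomial_map => [|k]; last by [].
by apply/rowP => k; rewrite !mxE.
Qed.

(** The density equals [1] at [0], so the metric is Euclidean there. *)
Lemma inner_origin u v : @inner R M origin u v = \sum_k u 0 k * v 0 k.
Proof.
apply: eq_bigr => k _.
by rewrite /round_density /= mulr0 addr0 invr1 !mul1r.
Qed.

End DiagonalDiffeo.

(** * Subspaces spanned by coordinate vectors *)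

Section CoordinateSubspace.
Context {R : realType} {n : nat}.
Implicit Types (S : {set 'I_n}) (a : 'I_n -> R) (v w : 'rV[R]_n).

Definition coord_space S : {vspace 'rV[R]_n} :=
  (\sum_(k in S) <[delta_mx 0%R k]>)%VS.

Lemma coord_spaceP S v :
  reflect (forall k, k \notin S -> v 0 k = 0) (v \in coord_space S).
Proof.
apply: (iffP idP) => [/memv_sumP[vs vsS ->] k kS|v0].
  rewrite summxE big1// => j jS; have /vlineP[c ->] := vsS j jS.
  by rewrite !mxE eqxx /= (_ : k == j = false) ?mulr0//; apply: contraNF kS => /eqP->.
rewrite [v]row_sum_delta; apply: memv_suml => k _.
have [kS|kS] := boolP (k \in S); last by rewrite v0// scale0r mem0v.
apply: memvZ; have := memv_line (delta_mx 0 k : 'rV[R]_n).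
by apply: subvP; exact: (sumv_sup k).
Qed.

Lemma coord_space_full S : (coord_space S + coord_space (~: S))%VS = fullv.
Proof.
apply/vspaceP => v; rewrite memvf; apply/memv_addP.
exists (\row_k (if k \in S then v 0 k else 0)).
  by apply/coord_spaceP => k /negPf kS; rewrite mxE kS.
exists (\row_k (if k \in S then 0 else v 0 k)).
  by apply/coord_spaceP => k; rewrite inE negbK mxE => ->.
by apply/rowP => k; rewrite !mxE; case: ifP => _; rewrite ?addr0 ?add0r.
Qed.

Lemma coord_space_cap S : (coord_space S :&: coord_space (~: S))%VS = 0%VS.
Proof.
apply/eqP; rewrite -subv0; apply/subvP => v /memv_capP[/coord_spaceP vS].
move=> /coord_spaceP vS'; rewrite memv0; apply/eqP/rowP => k; rewrite mxE.
have [kS|kS] := boolP (k \in S); last exact: vS.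
by apply: vS'; rewrite inE negbK.
Qed.

(** Spanning bounds the dimension by the cardinality for both [S] and its complement; the two spaces
    add up to the whole space, which forces equality. *)
Lemma dim_coord_space S : \dim (coord_space S) = #|S|.
Proof.
have ub (A : {set 'I_n}) : (\dim (coord_space A) <= #|A|)%N.
  apply: (leq_trans (dimv_leq_sum _ _ _)); rewrite -sum1_card.
  by apply: leq_sum => k _; rewrite dim_vline; case: (_ != _).
apply/eqP; rewrite eqn_leq ub /=.
rewrite -(leq_add2r #|~: S|) cardsC card_ord.
have dimn : \dim {: 'rV[R]_n} = n by rewrite dimvf dim_matrix; exact: mul1n.
rewrite -{1}dimn -(coord_space_full S).
by apply: (leq_trans (dimv_add_leqif _ _)); rewrite leq_add2l.
Qed.

Lemma limg_coord_space S a (T : 'End('rV[R]_n)) : (forall k, a k != 0) ->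
  (forall v, T v = \row_k (a k * v 0 k)) ->
  (T @: coord_space S)%VS = coord_space S.
Proof.
move=> a0 TE; apply/vspaceP => v; apply/memv_imgP/coord_spaceP.
  move=> [w /coord_spaceP wS ->] k kS.
  by rewrite TE mxE wS ?mulr0.
move=> vS; exists (\row_k ((a k)^-1 * v 0 k)).
  by apply/coord_spaceP => k kS; rewrite mxE vS ?mulr0.
by rewrite TE; apply/rowP => k; rewrite !mxE mulVKf.
Qed.

End CoordinateSubspace.

(** * Dynamical properties of a diagonal map at the fixed origin *)

Section OriginDynamics.
Context {R : realType} {n : nat}.
Local Notation M := (@round_power R n).
Local Notation o := (@origin R n).
Implicit Types (S : {set 'I_n}) (a : 'I_n -> R) (v w : 'rV[R]_n).

(** Over a single point, any basis of the fibre is a continuous frame. *)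
Lemma continuous_subbundle_origin (V : {vspace 'rV[R]_n}) :
  @continuous_subbundle R M [set o] (fun=> V).
Proof.
move=> _ ->; pose W := (to_chart (chart_at (o : M)) o @: V)%VS.
exists (dom (chart_at (o : M))), (\dim W), (fun j _ => tnth (vbasis W) j).
split=> //; first exact: dom_open.
  move=> _ -> _; have -> : [tuple tnth (vbasis W) j | j < \dim W] = vbasis W.
    by apply: eq_from_tnth => i; rewrite tnth_mktuple.
  exact: vbasisP.
by move=> j; exact: cst_continuous.
Qed.

Lemma splitting_origin a (a0 : forall k, a k != 0) S :
  @continuous_invariant_splitting R M (diag_diffeo a0) [set o]
    (fun=> coord_space S) (fun=> coord_space (~: S)).
Proof.
split; try exact: continuous_subbundle_origin.
- by move=> _ ->; apply: (limg_coord_space _ a0) => v; rewrite tangent_scalen.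
- by move=> _ ->; apply: (limg_coord_space _ a0) => v; rewrite tangent_scalen.
- by move=> x _; rewrite coord_space_full coord_space_cap.
Qed.

Lemma transitive_origin a (a0 : forall k, a k != 0) :
  @transitive_set R M (diag_diffeo a0) [set o].
Proof.
exists o => //; rewrite (_ : [set iter m _ _ | m in _] = [set o]).
  apply/esym/closure_id/accessible_closed_set1/hausdorff_accessible.
  exact: Pn_hausdorff.
apply/seteqP; split=> [_ [m _ <-]|_ ->].
  by rewrite /= iter_scalen scalen_origin.
by exists 1%N => //=; rewrite scalen_origin.
Qed.

Lemma tnorm_origin v : tnorm (o : M) v = Num.sqrt (\sum_k v 0 k ^+ 2).
Proof.
by rewrite /tnorm inner_origin; congr Num.sqrt; apply: eq_bigr => k _; rewrite expr2.
Qed.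

Lemma le_tnorm_origin v w : (forall k, `|v 0 k| <= `|w 0 k|) ->
  tnorm (o : M) v <= tnorm (o : M) w.
Proof.
move=> vw; rewrite !tnorm_origin ler_sqrt; last first.
  by apply: sumr_ge0 => k _; exact: sqr_ge0.
apply: ler_sum => k _; rewrite -(real_normK (num_real (v 0 k))).
rewrite -(real_normK (num_real (w 0 k))).
by rewrite ler_sqr ?nnegrE.
Qed.

Lemma tnorm_originZ c v : 0 <= c ->
  tnorm (o : M) (c *: v) = c * tnorm (o : M) v.
Proof.
move=> c0; rewrite !tnorm_origin.
have -> : \sum_k (c *: v) 0 k ^+ 2 = c ^+ 2 * \sum_k v 0 k ^+ 2.
  by rewrite mulr_sumr; apply: eq_bigr => k _; rewrite mxE exprMn.
by rewrite sqrtrM ?sqr_ge0// sqrtr_sqr ger0_norm.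
Qed.

Lemma tnorm_scalen_le a S c v : 0 <= c -> (forall k, k \in S -> `|a k| <= c) ->
  v \in coord_space S ->
  tnorm (o : M) (tangent_map (scalen a : M -> M) o v) <= c * tnorm (o : M) v.
Proof.
move=> c0 ac /coord_spaceP vS; rewrite -tnorm_originZ//.
apply: le_tnorm_origin => k; rewrite tangent_scalen !mxE !normrM (ger0_norm c0).
have [kS|kS] := boolP (k \in S); last by rewrite vS// normr0 !mulr0.
by rewrite ler_wpM2r ?ac.
Qed.

Lemma tnorm_scalen_ge a S c v : 0 <= c -> (forall k, k \in S -> c <= `|a k|) ->
  v \in coord_space S ->
  c * tnorm (o : M) v <= tnorm (o : M) (tangent_map (scalen a : M -> M) o v).
Proof.
move=> c0 ac /coord_spaceP vS; rewrite -tnorm_originZ//.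
apply: le_tnorm_origin => k; rewrite tangent_scalen !mxE !normrM (ger0_norm c0).
have [kS|kS] := boolP (k \in S); last by rewrite vS// normr0 !mulr0.
by rewrite ler_wpM2r ?ac.
Qed.

(** Choosing the rate [ln c] turns the exponential bounds of the definitions into powers of [c]. *)
Lemma expR_ln_natr (c : R) m : 0 < c -> expR (ln c * m%:R) = c ^+ m.
Proof. by move=> c0; rewrite expRM_natr lnK ?posrE. Qed.

Lemma contracted_origin a (a0 : forall k, a k != 0) S c : 1 < c ->
  (forall k, k \in S -> `|a k| <= c^-1) ->
  @uniformly_contracted R M (diag_diffeo a0) [set o] (fun=> coord_space S).
Proof.
move=> c1 ac; have c0 : 0 < c by exact: lt_trans ltr01 c1.
exists 1, (ln c); split => //; first exact: ln_gt0.
move=> _ v m -> vS _; rewrite /= iter_scalen scalen_origin mul1r expRN.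
rewrite expR_ln_natr// -exprVn; apply: tnorm_scalen_le vS.
  by rewrite exprn_ge0// invr_ge0 ltW.
by move=> k kS; rewrite normrX lerXn2r ?nnegrE ?invr_ge0 ?(ltW c0)// ac.
Qed.

Lemma expanded_origin a (a0 : forall k, a k != 0) S c : 1 < c ->
  (forall k, k \in S -> c <= `|a k|) ->
  @uniformly_expanded R M (diag_diffeo a0) [set o] (fun=> coord_space S).
Proof.
move=> c1 ac; have c0 : 0 < c by exact: lt_trans ltr01 c1.
exists 1, (ln c); split => //; first exact: ln_gt0.
move=> _ v m -> vS _; rewrite /= iter_scalen scalen_origin mul1r.
rewrite expR_ln_natr//; apply: tnorm_scalen_ge vS.
  by rewrite exprn_ge0// ltW.
by move=> k kS; rewrite normrX lerXn2r ?nnegrE ?(ltW c0)// ac.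
Qed.

(** The unit vector [delta_mx 0 k] lies in the subspace and is stretched by exactly [|a k|]. *)
Lemma opnorm_scalen_ge a S k : k \in S ->
  `|a k| <= @opnorm R M o o (tangent_map (scalen a : M -> M) o) (coord_space S).
Proof.
move=> kS; apply: ub_le_sup.
  (* [sup] dominates its elements only for a bounded set; the sum of all [|a j|] is a crude
     bound. *)
  exists (\sum_j `|a j|) => _ [v [vS v1] <-].
  have s0 : 0 <= \sum_j `|a j| by exact: sumr_ge0.
  rewrite -[leRHS]mulr1; apply: le_trans (ler_wpM2l s0 v1).
  apply: tnorm_scalen_le vS => // j _.
  by rewrite (bigD1 j)//= lerDl sumr_ge0.
have norm_delta c : tnorm (o : M) (c *: delta_mx 0 k) = `|c|.
  rewrite tnorm_origin (bigD1 k)//= big1 => [|j jk]; last first.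
    by rewrite !mxE eqxx (negPf jk) mulr0 expr0n.
  by rewrite !mxE !eqxx mulr1 addr0 sqrtr_sqr.
exists (delta_mx 0 k); last first.
  rewrite -norm_delta; congr tnorm; rewrite tangent_scalen.
  apply/rowP => j; rewrite !mxE eqxx /=.
  by have [->|] := eqVneq j k; rewrite // !mulr0.
split; last by rewrite -[delta_mx 0 k]scale1r norm_delta normr1.
apply/coord_spaceP => j jS; rewrite mxE eqxx /=.
by rewrite (_ : j == k = false)//; apply: contraNF jS => /eqP->.
Qed.

(** The two operator norms are at least [|a j| ^+ m] and [|a k| ^- m], so their product stays at
    least [1] and cannot decay exponentially. *)
Lemma not_dominated_origin a (a0 : forall k, a k != 0) S S' j k :
  j \in S -> k \in S' -> `|a k| <= `|a j| ->
  ~ @dominated R M (diag_diffeo a0) [set o]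
      (fun=> coord_space S) (fun=> coord_space S').
Proof.
move=> jS kS' ajk [K [l [K0 l0 dom]]].
have {}dom (m : nat) : (0 < m)%N -> expR (l * m%:R) < K.
  move=> m0; have := dom o m erefl m0.
  rewrite /= !iter_scalen scalen_origin => domm.
  have {domm} : 1 < K * expR (- (l * m%:R)).
    apply: le_lt_trans domm.
    have bj := opnorm_scalen_ge (fun i => a i ^+ m) jS.
    have bk := opnorm_scalen_ge (fun i => (a i)^-1 ^+ m) kS'.
    apply: le_trans (ler_pM (normr_ge0 _) (normr_ge0 _) bj bk).
    rewrite -normrM -exprMn normrX exprn_ege1// normrM normfV.
    by rewrite ler_pdivlMr ?normr_gt0// mul1r.
  by rewrite expRN ltr_pdivlMr ?expR_gt0// mul1r.
(* An iterate count above [K / l] contradicts [1 + x <= expR x]; its successor is used to make it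
   positive, as [dom] requires. *)
have := archi_boundP (divr_ge0 (ltW K0) (ltW l0)); set m := Num.bound _ => Km.
have {}Km : K < l * m.+1%:R.
  rewrite mulrC -ltr_pdivrMr//; apply: lt_le_trans Km _.
  by rewrite ler_nat.
have := lt_trans (dom m.+1 isT) Km.
rewrite ltNge => /negP; apply.
by apply: le_trans (expR_ge1Dx _); rewrite lerDr.
Qed.

(** The bundle has rank two, so its only plane is itself, and the determinant there is
    [(a s * a t) ^+ m] up to sign. *)
Lemma sectionally_expanding_origin a s t c : s != t -> 1 < c ->
  `|a s * a t| = c -> (forall k, a k != 0) ->
  @sectionally_expanding R M (scalen a) [set o] (fun=> coord_space [set s; t]).
Proof.
move=> st c1 ac a0; have c0 : 0 < c by exact: lt_trans ltr01 c1.
have dimF : \dim (coord_space [set s; t] : {vspace 'rV[R]_n}) = 2%N.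
  by rewrite dim_coord_space cards2 st.
split; first by exists 2%N.
(* The absolute determinant is exactly [c ^+ m]; the constant [2^-1] makes the inequality strict. *)
exists 2^-1, (ln c); split; [by rewrite invr_gt0|exact: ln_gt0|].
move=> _ L m -> LF dimL _ /=; rewrite iter_scalen scalen_origin => u w.
have {LF dimL}-> : L = coord_space [set s; t].
  by apply/eqP; rewrite eqEdim LF dimL dimF.
set b := fun k => a k ^+ m.
have b0 k : b k != 0 by rewrite expf_neq0.
rewrite (limg_coord_space _ b0); last by move=> v; rewrite tangent_scalen.
pose f (i : 'I_2) := if i == 0 then s else t.
(* One argument in the plane is enough to kill the terms outside [s] and [t]. *)
have innerE v v' : v \in coord_space [set s; t] ->
    @inner R M o v v' = \sum_(i < 2) v 0 (f i) * v' 0 (f i).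
  move=> /coord_spaceP vS; rewrite inner_origin (bigID (mem [set s; t]%SET))/=.
  rewrite [X in _ + X]big1 => [|k kS]; last first.
    by rewrite (vS _ kS) mul0r.
  rewrite addr0 big_setU1 ?inE// big_set1.
  by rewrite !big_ord_recl big_ord0 addr0.
(* In the coordinates [s] and [t] an orthonormal basis is an orthogonal matrix, of determinant [1]
   or [-1]. *)
have ortho (z : 2.-tuple 'rV[R]_n) :
    @orthonormal_basis R M o (coord_space [set s; t]) 2 z ->
    (forall i, tnth z i \in coord_space [set s; t]) /\
    `|\det (\matrix_(i < 2, j < 2) tnth z i 0 (f j))| = 1.
  move=> [zb zo]; have zF i : tnth z i \in coord_space [set s; t].
    exact/(basis_mem zb)/mem_tnth.
  split=> //; set Z := \matrix_(_, _) _.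
  have ZZ : Z *m Z^T = 1%:M.
    apply/matrixP => i j; rewrite !mxE -zo innerE//.
    by apply: eq_bigr => k _; rewrite !mxE.
  have /eqP : \det Z ^+ 2 = 1 by rewrite expr2 -{2}det_tr -det_mulmx ZZ det1.
  by rewrite sqrf_eq1 => /orP[] /eqP ->; rewrite ?normrN normr1.
move=> /ortho[uF du] /ortho[wF dw].
(* Orthogonal times diagonal times orthogonal: only the diagonal factor affects the absolute
   determinant. *)
have -> : @matrix_in R M o (tangent_map (scalen b : M -> M) o) 2 u w =
    (\matrix_(i < 2, j < 2) tnth u i 0 (f j)) *m diag_mx (\row_i b (f i))
    *m (\matrix_(i < 2, j < 2) tnth w i 0 (f j))^T.
  apply/matrixP => i j; rewrite !mxE inner_sym innerE//.
  apply: eq_bigr => k _; rewrite mul_mx_diag tangent_scalen !mxE; ring.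
rewrite !det_mulmx det_tr det_diag !normrM du dw mul1r mulr1.
rewrite !big_ord_recl big_ord0 mulr1 !mxE /= /b -exprMn normrX ac.
rewrite expR_ln_natr// ltr_pdivrMl//.
by rewrite mulr_natl mulr2n ltrDl exprn_gt0.
Qed.

End OriginDynamics.

(** * The four eigenvalues and the resulting example *)

Section Example.
Context {R : realType}.

Definition eigenvalue4 (k : 'I_4) : R := [:: 2; 8^-1; 2^-1; 8]`_k.

Lemma eigenvalue4_neq0 k : eigenvalue4 k != 0.
Proof.
by case: k => -[|[|[|[|//]]]] ? /=; rewrite /eigenvalue4 /= ?invr_eq0 pnatr_eq0.
Qed.

End Example.

Theorem proposition2 (R : realType) :
  exists (M : riemannianManifold R) (g : diffeo M) (Gamma : set M)
         (E F : M -> {vspace 'rV[R]_(mdim M)}),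
    [/\ compact [set: M],
        compact Gamma /\ g @` Gamma = Gamma,
        transitive_set g Gamma /\ hyperbolic_set g Gamma,
        continuous_invariant_splitting g Gamma E F /\ ~ dominated g Gamma E F
      & sectionally_expanding g Gamma F /\ sectionally_contracting g Gamma E].
Proof.
have a0 := @eigenvalue4_neq0 R.
pose s0 : 'I_4 := @Ordinal 4 0 isT; pose s1 : 'I_4 := @Ordinal 4 1 isT.
pose s2 : 'I_4 := @Ordinal 4 2 isT; pose s3 : 'I_4 := @Ordinal 4 3 isT.
(* [splitting_origin] expects the second bundle to be indexed by the complement of the first index
   set. *)
have c01 : (~: [set s0; s1] = [set s2; s3])%SET.
  by apply/setP => -[[|[|[|[|//]]]] ?]; rewrite !inE.
have c12 : (~: [set s1; s2] = [set s0; s3])%SET.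
  by apply/setP => -[[|[|[|[|//]]]] ?]; rewrite !inE.
exists (@round_power R 4), (diag_diffeo a0), [set origin],
  (fun=> coord_space [set s0; s1]), (fun=> coord_space [set s2; s3]).
split.
- exact: Pn_compact.
- split; first exact: compact_set1.
  by rewrite image_set1 /= scalen_origin.
- split; first exact: transitive_origin.
  exists (fun=> coord_space [set s1; s2]), (fun=> coord_space [set s0; s3]).
  split; first by rewrite -c12; exact: splitting_origin.
    (* The weaker eigenvalue of each bundle, [1/2] here and [2] below, dictates the constant [2]. *)
    apply: (@contracted_origin R 4 _ _ _ 2); first by rewrite ltr1n.
    move=> k; rewrite !inE => /orP[] /eqP ->; rewrite /eigenvalue4 /= ger0_norm//.
    by rewrite lef_pV2 ?posrE// ler_nat.
  apply: (@expanded_origin R 4 _ _ _ 2); first by rewrite ltr1n.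
  move=> k; rewrite !inE => /orP[] /eqP ->; rewrite /eigenvalue4 /= ger0_norm//.
  by rewrite ler_nat.
- split; first by rewrite -c01; exact: splitting_origin.
  (* The eigenvalue [2] in [E] exceeds the eigenvalue [1/2] in [F]. *)
  apply: (@not_dominated_origin R 4 _ _ _ _ s0 s2); rewrite ?inE ?eqxx ?orbT//.
  rewrite /eigenvalue4 /= !ger0_norm//.
  by lra.
- split.
    apply: (@sectionally_expanding_origin R 4 _ s2 s3 4) => //.
      by rewrite ltr1n.
    by rewrite /eigenvalue4 /= ger0_norm ?mulr_ge0//; lra.
  (* On [E] the inverse map has eigenvalues [1/2] and [8], again of product [4]. *)
  apply: (@sectionally_expanding_origin R 4 _ s0 s1 4) => //.
  - by rewrite ltr1n.
  - by rewrite /eigenvalue4 /= invrK ger0_norm ?mulr_ge0//; lra.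
  - by move=> k; rewrite invr_neq0.
Qed.
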